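(* For any metric space $(X,d)$, the following two conditions are quantitatively equivalent: (i) There exist a metric $d'$ on $X$ that is bi-Lipschitz equivalent to $d$ and a number $p>1$ such that $(X,(d')^p)$ is a metric space. (ii) There exist a metric $d''$ on $X$ that is bi-Lipschitz equivalent to $d$ and a number $0\le\alpha<1$ such that $(X,d'')$ satisfies the $\mathrm{SRA}(\alpha)$ condition.
   Context: For $0\le\alpha\le 1$, a metric space $(X,d)$ satisfies the $\mathrm{SRA}(\alpha)$ condition (small rough angles with parameter $\alpha$) if $d(x,y)\le\max\{d(x,z)+\alpha d(z,y),\ \alpha d(x,z)+d(z,y)\}$ for all $x,y,z\in X$. Two metrics $d,d'$ on a set $X$ are bi-Lipschitz equivalent if there is a constant $L>0$ with $\frac1L d(x,y)\le d'(x,y)\le L\,d(x,y)$ for all $x,y\in X$. ''Quantitatively equivalent'' means that each condition implies the other, with the constants in one condition (the exponent $p$, respectively the parameter $\alpha$, and the bi-Lipschitz constant) depending only on the constants in the other, and not otherwise on $(X,d)$. *)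

(* Defs.v *)
From HB Require Import structures.
From mathcomp Require Import all_boot all_order all_algebra.
From mathcomp Require Import all_classical all_reals all_analysis.

Set Implicit Arguments.
Unset Strict Implicit.
Unset Printing Implicit Defensive.

Import Order.TTheory GRing.Theory Num.Theory.

Local Open Scope ring_scope.

(* The library's [metricType] attaches one fixed distance to a type. Several
   metrics on the same set are compared here, so a metric is also needed as a
   predicate on functions; the fields are those of the factory [isMetric], from
   which nonnegativity follows. *)
Record is_metric (R : realType) (X : Type) (d : X -> X -> R) : Prop := IsMetric {
  is_metric_refl : forall x, d x x = 0 ;
  is_metric_eq : forall x y, d x y = 0 -> x = y ;
  is_metric_sym : forall x y, d x y = d y x ;
  is_metric_triangle : forall y x z, d x z <= d x y + d y z
}.

Lemma mdist_is_metric (R : realType) (X : metricType R) :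
  is_metric (fun x y : X => mdist x y).
Proof.
split; [exact: mdistxx | exact: mdist_positivity | exact: metric_sym |].
by move=> y x z; exact: metric_triangle.
Qed.

Definition bilipschitz (R : realType) (X : Type) (L : R) (d d' : X -> X -> R) :
    Prop :=
  forall x y, L^-1 * d x y <= d' x y /\ d' x y <= L * d x y.

Definition SRA (R : realType) (X : Type) (alpha : R) (d : X -> X -> R) : Prop :=
  forall x y z,
    d x y <= Num.max (d x z + alpha * d z y) (alpha * d x z + d z y).

Definition bilipschitz_to_snowflake (R : realType) (p L : R) (X : metricType R) :
    Prop :=
  exists d' : X -> X -> R,
    [/\ is_metric d',
        bilipschitz L (fun x y => mdist x y) d' &
        is_metric (fun x y => d' x y `^ p)].

Definition bilipschitz_to_SRA (R : realType) (alpha L : R) (X : metricType R) :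
    Prop :=
  exists d'' : X -> X -> R,
    [/\ is_metric d'',
        bilipschitz L (fun x y => mdist x y) d'' &
        SRA alpha d''].

(* Main.v *)
(* If d^p is a metric then d itself is SRA(1/p): for v <= u, the bound
   w^p <= u^p + v^p forces w <= u + v/p. Conversely SRA(alpha) implies
   d(x,y) <= (1 + alpha) max(d(x,z), d(z,y)) with 1 + alpha < 2, so for some
   p > 1 the function d^p is a quasi-ultrametric with constant 2; by Frink's
   lemma its chain metric rho satisfies rho <= d^p <= 4 rho, and rho^(1/p) is
   the required metric. *)

Require Import Defs.
From mathcomp Require Import all_boot all_order all_algebra.
From mathcomp Require Import all_classical all_reals all_analysis.
From mathcomp Require Import ring lra zify.

Import Order.TTheory GRing.Theory Num.Theory.

Local Open Scope ring_scope.

Lemma is_metric_ge0 {R : realType} {X : Type} {d : X -> X -> R} :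
  is_metric d -> forall x y, 0 <= d x y.
Proof.
move=> [d0 _ dC dT] x y.
by have := dT y x x; rewrite d0 (dC y x) -mulr2n pmulrn_lge0.
Qed.

(** * Inequalities for real powers *)

Section PowerMeans.
Context {R : realType}.
Implicit Types a b p s u v w : R.

(** Since [c = c^s c^(1 - s)], multiplying by [(a + b)^(1 - s)] leaves [a + b] on the left, and
    monotonicity of [c^(1 - s)] bounds each summand separately. *)
Lemma powR_subadditive s a b :
  0 < s <= 1 -> 0 <= a -> 0 <= b -> (a + b) `^ s <= a `^ s + b `^ s.
Proof.
move=> /andP[s0 s1] a0 b0.
have [ab0|abn0] := eqVneq (a + b) 0.
  by rewrite ab0 powR0 ?gt_eqF// addr_ge0 ?powR_ge0.
have ab_gt0 : 0 < a + b by rewrite lt0r abn0 addr_ge0.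
have split_powR c : 0 <= c -> c = c `^ s * c `^ (1 - s).
  move=> c0; rewrite -powRD ?subrKC ?powRr1//.
  by rewrite oner_eq0.
rewrite -(ler_pM2r (powR_gt0 (1 - s) ab_gt0)) -split_powR ?(ltW ab_gt0)//.
rewrite mulrDl lerD// {1}[X in X <= _]split_powR// ler_wpM2l ?powR_ge0//.
  by apply: ge0_ler_powR; rewrite ?nnegrE ?subr_ge0 ?lerDl ?(ltW ab_gt0).
by apply: ge0_ler_powR; rewrite ?nnegrE ?subr_ge0 ?lerDr ?(ltW ab_gt0).
Qed.

Lemma powR_inv_subadditive {p a b} :
  1 < p -> 0 <= a -> 0 <= b -> (a + b) `^ p^-1 <= a `^ p^-1 + b `^ p^-1.
Proof.
move=> p1 a0 b0; have p0 : 0 < p by apply: lt_trans p1.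
by apply: powR_subadditive; rewrite // invr_gt0 p0 invf_le1 ?(ltW p1).
Qed.

Lemma powR_invK {p a} : p != 0 -> 0 <= a -> (a `^ p) `^ p^-1 = a.
Proof. by move=> p0 a0; rewrite -powRrM mulfV ?powRr1. Qed.

Lemma powRK_inv {p a} : p != 0 -> 0 <= a -> (a `^ p^-1) `^ p = a.
Proof. by move=> p0 a0; rewrite -powRrM mulVf ?powRr1. Qed.

(* Young's inequality applied to [w * u `^ (p - 1)]. *)
Lemma le_add_of_powR_le {p u v w} :
  1 < p -> 0 <= w -> 0 <= v <= u ->
  w `^ p <= u `^ p + v `^ p -> w <= u + p^-1 * v.
Proof.
move=> p1 w0 /andP[v0 vu] wp.
have p0 : 0 < p by apply: lt_trans p1.
have u0 : 0 <= u by apply: le_trans vu.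
have [u_eq0|un0] := eqVneq u 0.
  have v_eq0 : v = 0 by apply/le_anti; rewrite v0 andbT -u_eq0.
  move: wp; rewrite u_eq0 v_eq0 powR0 ?gt_eqF// mulr0 !addr0 => wp.
  have /eqP/powR_eq0_eq0 -> // : w `^ p == 0 by rewrite eq_le wp powR_ge0.
have u_gt0 : 0 < u by rewrite lt0r un0.
have um0 : 0 < u `^ (p - 1) by exact: powR_gt0.
(* The conjugate exponent of [p] turns [u^(p - 1)] into [u^p], so Young gives
   [w u^(p - 1) <= w^p / p + (1 - 1/p) u^p]. *)
have q0 : 0 < p / (p - 1) by rewrite divr_gt0// subr_gt0.
have conj_pq : p^-1 + (p / (p - 1))^-1 = 1 by field; rewrite !gt_eqF ?subr_gt0.
rewrite -(ler_pM2r um0).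
have := conjugate_powR w0 (powR_ge0 u (p - 1)) p0 q0 conj_pq.
rewrite -powRrM mulrCA mulfV ?gt_eqF ?subr_gt0// mulr1.
move=> /le_trans; apply.
(* Here [v <= u] makes the bound linear in [v], with the factor [u^(p - 1)] that is to be
   cancelled. *)
have vp : v `^ p <= v * u `^ (p - 1).
  rewrite -mulr_powRB1// ler_wpM2l//.
  by apply: ge0_ler_powR; rewrite ?nnegrE ?subr_ge0 ?(ltW p1).
rewrite mulrDl mulr_powRB1// -mulrA.
have -> : u `^ p / (p / (p - 1)) = u `^ p - p^-1 * u `^ p.
  by field; rewrite !gt_eqF ?subr_gt0.
have : p^-1 * w `^ p <= p^-1 * (u `^ p + v * u `^ (p - 1)).
  by rewrite ler_pM2l ?invr_gt0//; apply: le_trans wp _; rewrite lerD2l.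
rewrite [w `^ p / p]mulrC mulrDr; lra.
Qed.

Lemma exists_exponent {a} :
  0 <= a < 1 -> exists2 p : R, 1 < p & (1 + a) `^ p <= 2.
Proof.
(* The exponent [ln 2 / ln (1 + a)] would degenerate at [a = 0]; the midpoint [b] of [a] and [1]
   keeps the logarithm positive and below [ln 2]. *)
move=> /andP[a0 a1]; pose b := (1 + a) / 2.
have b_gt0 : 0 < ln (1 + b) by apply: ln_gt0; rewrite /b; lra.
have b2 : ln (1 + b) < ln 2 by rewrite ltr_ln ?posrE /b; lra.
exists (ln 2 / ln (1 + b)); first by rewrite ltr_pdivlMr ?mul1r.
have E : (1 + b) `^ (ln 2 / ln (1 + b)) = 2.
  by rewrite /powR gt_eqF ?divfK ?gt_eqF// ?lnK ?posrE// /b; lra.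
have ln2_gt0 := lt_trans b_gt0 b2.
rewrite -[leRHS]E; apply: ge0_ler_powR; rewrite ?nnegrE ?divr_ge0 ?(ltW ln2_gt0) ?(ltW b_gt0)//
  /b; lra.
Qed.

End PowerMeans.

(** * From a snowflake to small rough angles *)

Lemma snowflake_SRA {R : realType} {X : Type} (p : R) (d : X -> X -> R) :
  1 < p -> is_metric d -> is_metric (fun x y => d x y `^ p) -> SRA p^-1 d.
Proof.
move=> p1 d_metric dp_metric x y z.
have d0 := is_metric_ge0 d_metric.
have dT := is_metric_triangle dp_metric z x y.
(* The larger of the two distances takes the role of [u] and selects the branch of the maximum. *)
rewrite le_max; apply/orP; have [xz_le|/ltW zy_le] := leP (d x z) (d z y).
  right; rewrite addrC; apply: (le_add_of_powR_le p1); rewrite ?d0//.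
  by rewrite addrC.
by left; apply: (le_add_of_powR_le p1); rewrite ?d0.
Qed.

(** * Frink's lemma and the chain metric *)

Section ChainMetric.
Context {R : realType} {X : Type} (f : X -> X -> R).
Hypothesis f0 : forall x, f x x = 0.
Hypothesis f_eq : forall x y, f x y = 0 -> x = y.
Hypothesis f_ge0 : forall x y, 0 <= f x y.
Hypothesis fC : forall x y, f x y = f y x.
Hypothesis f2 : forall x y z, f x y <= 2 * Num.max (f x z) (f z y).

(* Since [min a b <= (a + b) / 2], splitting the chain at the last point from
   which the endpoint is at least half as far as from the start costs nothing:
   the edge following it is an end edge of both pieces. *)
Lemma frink_chain (u : nat -> X) (m i : nat) :
  f (u i) (u (i + m).+1) <=
    2 * (f (u i) (u i.+1) + 2 * (\sum_(i.+1 <= k < i + m) f (u k) (u k.+1))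
         + f (u (i + m)%N) (u (i + m).+1)).
Proof.
elim/ltn_ind: m i => m IH i; set D := f (u i) _.
pose P k := (k <= m)%N && (D <= 2 * f (u (i + k)%N) (u (i + m).+1)).
have P0 : exists k, P k.
  exists 0%N; rewrite /P /= addn0 -/D.
  by have := f_ge0 (u i) (u (i + m).+1); rewrite -/D; lra.
have Pm k : P k -> (k <= m)%N by case/andP.
case: (ex_maxnP P0 Pm) => q /andP[qm Dq] qmax.
have e_ge0 k := f_ge0 (u k) (u k.+1).
have S0 : 0 <= \sum_(i.+1 <= k < i + m) f (u k) (u k.+1) by apply: sumr_ge0.
have ei := e_ge0 i; have em := e_ge0 (i + m)%N.
(* If [q = m], the last edge alone is at least [D / 2]. *)
move: qm; rewrite leq_eqVlt => /predU1P[qE|qm]; first by rewrite qE in Dq; lra.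
(* By maximality of [q], the next point is closer than [D / 2] to the end, so [f2] can only hold
   through its distance from the start. *)
have Dq1 : D <= 2 * f (u i) (u (i + q).+1).
  have : ~~ P q.+1 by apply/negP => /qmax; rewrite ltnn.
  rewrite /P qm /= -ltNge addnS => lt_D.
  have := f2 (u i) (u (i + m).+1) (u (i + q).+1); rewrite -/D.
  by rewrite maxEle; case: ifP => _; lra.
case: q => [|q] in qm Dq Dq1 qmax *; first by rewrite addn0 in Dq1; lra.
(* Adding the two bounds on [D / 2], the shared edge is counted once in each piece and so receives
   the weight 2 of an inner edge. *)
have := IH _ qm i.
have := IH (m - q.+1)%N ltac:(lia) (i + q.+1)%N.
have -> : (i + q.+1 + (m - q.+1) = i + m)%N by lia.
rewrite (@big_cat_nat _ _ _ (i + q.+1)%N i.+1 (i + m)%N)/=; [|lia..].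
rewrite (@big_ltn _ _ _ (i + q.+1)%N (i + m)%N)/=; last lia.
lra.
Qed.

Definition chain_sums (x y : X) : set R :=
  [set s | exists n (u : nat -> X),
    [/\ u 0%N = x, u n = y & s = \sum_(0 <= k < n) f (u k) (u k.+1)]].

Definition chain_metric (x y : X) : R := inf (chain_sums x y).

Lemma chain_sums_edge x y : chain_sums x y (f x y).
Proof.
exists 1%N, (fun k => if k is 0%N then x else y).
by split=> //; rewrite big_nat1.
Qed.

Lemma chain_sums_ge0 x y s : chain_sums x y s -> 0 <= s.
Proof. by move=> [n [u [_ _ ->]]]; apply: sumr_ge0. Qed.

(** The 4 is the weight of inner edges in [frink_chain]; end edges are raised to it. A single edge
    is both first and last, so it too has weight 4. *)
Lemma chain_sums_lower x y s : chain_sums x y s -> f x y <= 4 * s.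
Proof.
move=> [n [u [<- <- ->]]]; case: n => [|n].
  by rewrite f0 big_geq// mulr0.
have := frink_chain u n 0; rewrite add0n.
have ge0 k := f_ge0 (u k) (u k.+1).
case: n => [|n]; first by rewrite big_geq// big_nat1; have := ge0 0%N; lra.
rewrite (@big_ltn _ _ _ 0%N)// (@big_nat_recr _ _ _ n.+1)//=.
by have := ge0 0%N; have := ge0 n.+1; lra.
Qed.

Lemma chain_sums_sym x y s : chain_sums x y s -> chain_sums y x s.
Proof.
move=> [n [u [ux uy ->]]]; exists n, (fun k => u (n - k)%N).
rewrite subn0 subnn; split=> //.
rewrite big_nat_rev/= big_nat [RHS]big_nat; apply: eq_bigr => k kn.
by rewrite fC; congr (f (u _) (u _)); lia.
Qed.

Lemma chain_sums_cat {x y z s t} :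
  chain_sums x y s -> chain_sums y z t -> chain_sums x z (s + t).
Proof.
move=> [n [u [ux uy ->]]] [m [v [vy vz ->]]].
pose w k := if (k < n)%N then u k else v (k - n)%N.
(* The junction [k = n] is included, as [u n = y = v 0]; the edge ending there needs it. *)
have wu k : (k <= n)%N -> w k = u k.
  rewrite /w; case: ltnP => // nk kn.
  by have -> : k = n by [lia]; rewrite subnn uy.
exists (n + m)%N, w; split; first by rewrite wu.
  by rewrite /w ltnNge leq_addr /= addKn.
rewrite (@big_cat_nat _ _ _ n 0%N (n + m)%N)//= ?leq_addr//; congr (_ + _).
  rewrite big_nat [RHS]big_nat; apply: eq_bigr => k /andP[_ kn].
  by rewrite !wu// ltnW.
rewrite -[X in _ = \big[_/_]_(X <= _ < _) _]add0n big_addn addKn; apply: eq_bigr => k _.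
by rewrite /w !ltnNge leqW ?leq_addl//= -addSn !addnK.
Qed.

(** A real [inf] is meaningful only for nonempty sets bounded below: 0 is a lower bound here, and
    the one-edge chain gives nonemptiness in the next lemma. *)
Lemma chain_metric_lbound {x y s} : chain_sums x y s -> chain_metric x y <= s.
Proof.
move=> xys; apply: ge_inf => //.
by exists 0 => t; exact: chain_sums_ge0.
Qed.

Lemma chain_metric_glb x y c :
  (forall s, chain_sums x y s -> c <= s) -> c <= chain_metric x y.
Proof.
by move=> xyc; apply: lb_le_inf => //; exists (f x y); exact: chain_sums_edge.
Qed.

Lemma chain_metric_le x y : chain_metric x y <= f x y.
Proof. exact/chain_metric_lbound/chain_sums_edge. Qed.

Lemma chain_metric_ge x y : f x y <= 4 * chain_metric x y.
Proof.
rewrite mulrC -ler_pdivrMr//; apply: chain_metric_glb => s /chain_sums_lower.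
by rewrite ler_pdivrMr// mulrC.
Qed.

Lemma chain_metricP : is_metric chain_metric.
Proof.
have ge0 x y : 0 <= chain_metric x y.
  by apply: chain_metric_glb => s; exact: chain_sums_ge0.
split=> [x|x y xy|x y|y x z].
- by apply/le_anti; rewrite ge0 andbT -[leRHS](f0 x) chain_metric_le.
- apply/f_eq/le_anti; rewrite f_ge0 andbT.
  by have := chain_metric_ge x y; rewrite xy mulr0.
- by apply/le_anti/andP; split; apply: chain_metric_glb => s /chain_sums_sym;
    exact: chain_metric_lbound.
(* The two infima on the right are removed in turn, each isolated by moving the other term across;
   concatenation then concludes. *)
- rewrite -lerBlDr; apply: chain_metric_glb => s xys.
  rewrite lerBlDr addrC -lerBlDr; apply: chain_metric_glb => t yzt.
  by rewrite lerBlDr addrC; exact/chain_metric_lbound/(chain_sums_cat xys yzt).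
Qed.

End ChainMetric.

(** * From small rough angles to a snowflake *)

Lemma is_metric_root {R : realType} {X : Type} (p : R) (d : X -> X -> R) :
  1 < p -> is_metric d -> is_metric (fun x y => d x y `^ p^-1).
Proof.
move=> p1 d_metric; have d_ge0 := is_metric_ge0 d_metric.
have p0 : 0 < p by apply: lt_trans p1.
case: d_metric => d0 d_eq dC dT; split=> [x|x y|x y|y x z].
- by rewrite d0 powR0 ?invr_eq0 ?gt_eqF.
- by move=> /powR_eq0_eq0/d_eq.
- by rewrite dC.
- apply: le_trans (powR_inv_subadditive p1 (d_ge0 _ _) (d_ge0 _ _)).
  by apply: ge0_ler_powR; rewrite ?nnegrE ?invr_ge0 ?addr_ge0 ?(ltW p0).
Qed.

Lemma SRA_quasi_ultrametric {R : realType} {X : Type} (alpha : R)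
    (d : X -> X -> R) (x y z : X) :
  0 <= alpha -> SRA alpha d -> d x y <= (1 + alpha) * Num.max (d x z) (d z y).
Proof.
move=> alpha0 /(_ x y z) /le_trans; apply.
rewrite ge_max; apply/andP.
by split; have [h|/ltW h] := leP (d x z) (d z y); nra.
Qed.

Lemma SRA_snowflake {R : realType} {X : Type} (p alpha : R) (d : X -> X -> R) :
  0 <= alpha -> 1 < p -> (1 + alpha) `^ p <= 2 -> is_metric d -> SRA alpha d ->
  exists d' : X -> X -> R,
    [/\ is_metric d', is_metric (fun x y => d' x y `^ p) &
        forall x y, d' x y <= d x y <= 4 * d' x y].
Proof.
move=> alpha0 p1 p2 d_metric d_SRA; have d_ge0 := is_metric_ge0 d_metric.
have p0 : 0 < p by apply: lt_trans p1.
have pn0 : p != 0 by rewrite gt_eqF.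
have powR_mono : {in Num.nneg &, {homo (fun a : R => a `^ p) : a b / a <= b}}.
  by apply: ge0_ler_powR; rewrite ltW.
have powRV_mono :
    {in Num.nneg &, {homo (fun a : R => a `^ p^-1) : a b / a <= b}}.
  by apply: ge0_ler_powR; rewrite invr_ge0 ltW.
pose f x y := d x y `^ p.
have f0 x : f x x = 0 by rewrite /f (is_metric_refl d_metric) powR0.
have f_eq x y : f x y = 0 -> x = y.
  by move=> /powR_eq0_eq0; exact: (is_metric_eq d_metric).
have f_ge0 x y : 0 <= f x y by exact: powR_ge0.
have fC x y : f x y = f y x by rewrite /f (is_metric_sym d_metric).
(* The choice of [p] makes the constant [(1 + alpha)^p] at most 2. *)
have f2 x y z : f x y <= 2 * Num.max (f x z) (f z y).
  have max_ge0 : 0 <= Num.max (d x z) (d z y) by rewrite le_max d_ge0.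
  apply: (@le_trans _ _ (((1 + alpha) * Num.max (d x z) (d z y)) `^ p)).
    apply: powR_mono; rewrite ?nnegrE ?mulr_ge0 ?addr_ge0//.
    exact: SRA_quasi_ultrametric.
  rewrite powRM ?addr_ge0// ler_pM ?powR_ge0//.
  by rewrite {1}maxEle le_max; case: ifP => _; rewrite lexx ?orbT.
have rho_metric := chain_metricP f f0 f_eq f_ge0 fC f2.
have rho_ge0 := is_metric_ge0 rho_metric.
exists (fun x y => chain_metric f x y `^ p^-1); split=> [||x y].
- exact: is_metric_root.
- rewrite (_ : (fun x y => _) = chain_metric f)//.
  by apply/funext => x; apply/funext => y; rewrite powRK_inv.
- rewrite -[d x y](powR_invK pn0)//; apply/andP; split.
    by apply: powRV_mono; rewrite ?nnegrE ?powR_ge0 ?rho_ge0 ?(chain_metric_le f).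
  apply: (@le_trans _ _ ((4 * chain_metric f x y) `^ p^-1)).
    by apply: powRV_mono; rewrite ?nnegrE ?powR_ge0 ?mulr_ge0 ?(chain_metric_ge f).
  (* Bounding [4^(1/p)] by 4 makes the constant independent of [p]. *)
  rewrite powRM// ler_wpM2r ?powR_ge0// ler1_powR ?invf_le1 ?(ltW p1)//.
  by rewrite ler1n.
Qed.

(** Quantitative dependence is expressed by choosing the new constants before [X]. *)
Theorem theorem1p1 (R : realType) :
  (forall p L : R, 1 < p -> 0 < L ->
     exists alpha L' : R,
       [/\ 0 <= alpha < 1,
           0 < L' &
           forall X : metricType R,
             bilipschitz_to_snowflake p L X ->
             bilipschitz_to_SRA alpha L' X])
  /\
  (forall alpha L : R, 0 <= alpha < 1 -> 0 < L ->
     exists p L' : R,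
       [/\ 1 < p,
           0 < L' &
           forall X : metricType R,
             bilipschitz_to_SRA alpha L X ->
             bilipschitz_to_snowflake p L' X]).
Proof.
split=> [p L p1 L0|alpha L alpha01 L0].
  have p0 : 0 < p by apply: lt_trans p1.
  exists p^-1, L; split=> [||X [d' [d'_metric d'_bilip d'p_metric]]] //.
    by rewrite invr_ge0 ltW//= invf_lt1.
  by exists d'; split=> //; exact: snowflake_SRA.
have [p p1 p2] := exists_exponent alpha01.
have /andP[alpha0 _] := alpha01.
(* The factor 4 is lost only in the lower bound, through [d <= 4 d']; the upper bound already holds
   with [L]. *)
exists p, (4 * L); split=> [||X [d [d_metric d_bilip d_SRA]]] //.
  by rewrite mulr_gt0.
have [d' [d'_metric d'p_metric d'_d]] :=
  SRA_snowflake _ _ _ alpha0 p1 p2 d_metric d_SRA.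
exists d'; split=> // x y.
have [lo hi] := d_bilip x y; have /andP[d'd dd'] := d'_d x y.
split; last by have := is_metric_ge0 d'_metric x y; lra.
rewrite invfM -mulrA ler_pdivrMl//; exact: le_trans dd'.
Qed.
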